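(* Let $1\le k<n$ be integers and let $(s_1,\ldots,s_k)$ be a non-decreasing sequence of integers with $l\le s_l<n$ for every $1\le l\le k$. Put $t_l:=s_l-l+1$ for $1\le l\le k$. Then the probability of success of the policy associated with $(s_1,\ldots,s_k)$ is equal to $$-\sum_{i=0}^{k-1}\left(\prod_{j=1}^i t_j\right)d_i(t_{i+1})-\left(\prod_{j=1}^k t_j\right)\delta_{k,n},$$ where the empty product is $1$, $$\delta_{k,n}:=\begin{cases}-\frac{1}{n}\sum_{j=1}^{n-1}\frac{1}{j},& k=1,\\[4pt] \frac{(n-k)!}{n!},& k>1,\end{cases}$$ and for $0\le l\le k$ the map $d_l\colon\{1,\ldots,n-l\}\to\mathbb{R}$ is $$d_l(x):=\begin{cases}-1+\frac{kx}{n}+\frac{\binom{n-x-1}{k}}{\binom{n}{k}}+\frac{x}{\binom{n}{k}}\sum_{j=1}^{x}\frac{\binom{n-j-1}{k-1}}{j},& l=0,\\[6pt] -\frac{k}{n}-\frac{1}{\binom{n}{k}}\sum_{j=1}^{x}\frac{\binom{n-j-1}{k-1}}{j},& l=1,\\[6pt] \frac{k\cdot x!\,(n-l-x)!}{l(l-1)\,n!}\sum_{j=0}^{l-2}\binom{k-1}{j}\binom{n-k}{x+l-j-1},& 1<l\le k.\end{cases}$$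
   Context: Binomial convention: for integers $m,j$, $\binom{m}{j}=\frac{m(m-1)\cdots(m-j+1)}{j!}$ if $j\ge 0$ and $\binom{m}{j}=0$ if $j<0$. Setting (generalized secretary problem). There are $n$ candidates with distinct ranks $1,\ldots,n$ (rank $1$ is the best) arriving in uniformly random order: all $n!$ orderings are equally likely. An ordering is a permutation $\pi$ of $\{1,\ldots,n\}$, where $\pi(i)$ is the rank of the $i$-th candidate. At time $i$ only the relative ranks of the first $i$ candidates are known. Success means selecting a candidate of rank in $\{1,\ldots,k\}$. Policy associated with a sequence. Let $(s_1,\ldots,s_k)$ be a non-decreasing sequence of integers with $l\le s_l<n$ for every $1\le l\le k$, and put $s_{k+1}:=n-1$. The policy with this sequence selects the $i_0$-th candidate, where $i_0\in\{1,\ldots,n\}$ is the smallest integer for which there is $l\in\{1,\ldots,k\}$ with (i) $s_l<i_0\le s_{l+1}$, and (ii) the $i_0$-th candidate is one of the $l$ best among the first $i_0$ candidates. If no such $i_0$ exists, it selects the $n$-th candidate. *)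

(* Defs.v *)
From HB Require Import structures.
From mathcomp Require Import all_boot all_order all_fingroup all_algebra.

Set Implicit Arguments.
Unset Strict Implicit.
Unset Printing Implicit Defensive.

Import Order.TTheory GRing.Theory Num.Theory.

Local Open Scope ring_scope.

(* Binomial coefficient with arbitrary integer arguments; the library's
   'C(m, j) covers only natural ones (see binzE). *)
Definition binz (R : realFieldType) (m j : int) : R :=
  if 0 <= j then (\prod_(i < `|j|%N) (m - i%:Z)%:~R) / (`|j|%N)`!%:R else 0.

Lemma binzE (R : realFieldType) (m j : nat) :
  binz R m%:Z j%:Z = 'C(m, j)%:R.
Proof.
rewrite /binz /=.
have fj0 : j`!%:R != 0 :> R by rewrite pnatr_eq0 -lt0n fact_gt0.
apply: (mulIf fj0); rewrite divfK // -natrM bin_ffact.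
elim: j {fj0} => [|j IHj]; first by rewrite big_ord0 ffactn0.
rewrite big_ord_recr /= IHj ffactnSr natrM.
have [lt_mj|le_jm] := ltnP m j; first by rewrite ffact_small // !mul0r.
by rewrite subzn.
Qed.

(* A permutation pi : 'S_n is an ordering of the candidates.  As 'I_n is
   {0, ..., n - 1}, the index p stands for the candidate arriving at time p.+1,
   whose rank is (pi p).+1; rank 1 is the best. *)
Section Policy.

Variables (n k : nat) (s : nat -> nat) (pi : 'S_n).

Definition rank (p : 'I_n) : nat := (pi p).+1.

(* Rank of candidate p among the candidates arrived up to and including p. *)
Definition relative_rank (p : 'I_n) : nat :=
  #|[set q : 'I_n | (q <= p)%N && (rank q <= rank p)%N]|.

(* The sequence s_1, ..., s_k, s_{k+1} := n - 1; the values of s outside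
   {1, ..., k} are never used. *)
Definition threshold (l : nat) : nat := if l == k.+1 then n.-1 else s l.

Definition acceptable (p : 'I_n) : bool :=
  [exists l : 'I_k.+1,
    [&& (0 < l)%N, (threshold l < p.+1 <= threshold l.+1)%N
      & (relative_rank p <= l)%N]].

Definition selects (p : 'I_n) : bool :=
  (acceptable p && [forall q : 'I_n, (q < p)%N ==> ~~ acceptable q])
  || ((p.+1 == n) && [forall q : 'I_n, ~~ acceptable q]).

Definition success : bool :=
  [exists p : 'I_n, selects p && (rank p <= k)%N].

End Policy.

(* Probability for the uniform distribution on the n! orderings. *)
Definition success_probability (R : realFieldType) (n k : nat)
    (s : nat -> nat) : R :=
  #|[set pi : 'S_n | success k s pi]|%:R / n`!%:R.

(* Meaningful for 1 <= k. *)
Definition delta (R : realFieldType) (k n : nat) : R :=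
  if k == 1%N then - (n%:R^-1 * \sum_(1 <= j < n) j%:R^-1)
  else (n - k)`!%:R / n`!%:R.

(* Meaningful for 0 <= l <= k and 1 <= x <= n - l; the upper argument of a
   binomial can be -1 when l = 0 and x = n. *)
Definition d (R : realFieldType) (n k l x : nat) : R :=
  match l with
  | 0 =>
      - 1 + k%:R * x%:R / n%:R
      + binz R (n%:Z - x%:Z - 1) k%:Z / binz R n%:Z k%:Z
      + x%:R / binz R n%:Z k%:Z
        * \sum_(1 <= j < x.+1) binz R (n%:Z - j%:Z - 1) (k%:Z - 1) / j%:R
  | 1 =>
      - (k%:R / n%:R)
      - (binz R n%:Z k%:Z)^-1
        * \sum_(1 <= j < x.+1) binz R (n%:Z - j%:Z - 1) (k%:Z - 1) / j%:R
  | _ =>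
      (k%:R * x`!%:R * (n - l - x)`!%:R) / (l%:R * (l%:R - 1) * n`!%:R)
      * \sum_(0 <= j < l.-1)
          binz R (k%:Z - 1) j%:Z
          * binz R (n%:Z - k%:Z) (x%:Z + l%:Z - j%:Z - 1)
  end.

(* Main.v *)
Require Import Defs.
From HB Require Import structures.
From mathcomp Require Import all_boot all_order all_fingroup all_algebra.
From mathcomp Require Import zify ring.

Set Implicit Arguments.
Unset Strict Implicit.
Unset Printing Implicit Defensive.

Import Order.TTheory GRing.Theory Num.Theory.

Local Open Scope ring_scope.

(* Let X_i be the number of the k best candidates among the first i ones.
   Removing the last candidate from a uniform ordering shows that a rule which
   stops at the first time i such that the relative rank is at most L(i)
   succeeds with probability
     sum_i P(no stop before i) / i * E min(L(i), X_i),
   because the success probability and the hypergeometric means on the right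
   satisfy the same recursion in (n, k).  When L = l on s_l < i <= s_{l+1},
   P(no stop up to i) = t_1 ... t_l (i - l)! / i!, and for l > 1 the summand
   (i - l - 1)! / i! E min(l, X_i) is the increment in i of
     - (i - l)! / i! E min(l - 1, X_i) / (l - 1),
   since x min(l-1, x-1) + (l - x) min(l-1, x) = (l-1) min(l, x).  Summation by
   parts over the thresholds leaves the terms d_l and delta. *)

(** * Removing the last candidate from an ordering *)

Lemma bump_ord (m : nat) (q : 'I_m) : bump m q = q.
Proof. by rewrite -[RHS]lift_max. Qed.

(** An ordering is determined by the rank of its last candidate and the relative order of the
    others; injectivity and equal cardinalities make this a bijection. *)
Lemma sum_perm_lift (m : nat) (f : 'S_m.+1 -> nat) :
  (\sum_(pi : 'S_m.+1) f pi
   = \sum_(sg : 'S_m) \sum_(v : 'I_m.+1) f (lift_perm ord_max v sg))%N.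
Proof.
pose h (x : 'S_m * 'I_m.+1) := lift_perm ord_max x.2 x.1.
have inj_h : injective h.
  move=> [sg v] [sg' v'] eq_h.
  have /= eq_v : v = v'.
    by have := congr1 (fun pi : 'S__ => pi ord_max) eq_h; rewrite !lift_perm_id.
  congr (_, _) => //; apply/permP => i.
  have := congr1 (fun pi : 'S__ => pi (lift ord_max i)) eq_h.
  by rewrite !lift_perm_lift /= eq_v => /lift_inj.
have bij_h : bijective h.
  by apply: inj_card_bij => //; rewrite card_prod !card_Sn card_ord factS mulnC.
by rewrite (reindex h) ?pair_bigA //; apply: onW_bij.
Qed.

Lemma relative_rank_ord_max (m : nat) (pi : 'S_m.+1) :
  relative_rank pi ord_max = rank pi ord_max.
Proof.
rewrite /relative_rank /rank.
have -> : [set q : 'I_m.+1 | (q <= @ord_max m)%N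
             && ((pi q).+1 <= (pi ord_max).+1)%N]
          = pi @^-1: [set v : 'I_m.+1 | (v <= pi ord_max)%N].
  by apply/setP => q; rewrite !inE -ltnS ltn_ord.
rewrite (card_preimset _ (@perm_inj _ pi)) -sum1_card.
under eq_bigl do rewrite inE -ltnS.
by rewrite -(big_ord_widen _ (fun=> 1%N)) // sum1_card card_ord.
Qed.

(** The newcomer arrives after [p], and inserting its rank preserves the order of the earlier
    ones. *)
Lemma relative_rank_lift (m : nat) (sg : 'S_m) (v : 'I_m.+1) (p : 'I_m) :
  relative_rank (lift_perm ord_max v sg) (lift ord_max p) = relative_rank sg p.
Proof.
rewrite /relative_rank /rank -[RHS](card_imset _ (@lift_inj _ (@ord_max m))).
apply: eq_card => q.
have [q' ->|->] := unliftP ord_max q.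
  rewrite mem_imset ?inE ?lift_perm_lift /= ?ltnS ?leq_bump2 //.
  exact: lift_inj.
rewrite !inE lift_max leqNgt ltn_ord /=; apply/esym/imsetP => -[i _ /eqP].
by rewrite (negPf (neq_lift _ _)).
Qed.

Lemma relative_rank_gt0 (m : nat) (pi : 'S_m) (p : 'I_m) :
  (0 < relative_rank pi p)%N.
Proof. by apply/card_gt0P; exists p; rewrite inE !leqnn. Qed.

Lemma relative_rank_le (m : nat) (pi : 'S_m) (p : 'I_m) :
  (relative_rank pi p <= p.+1)%N.
Proof.
have <- : #|[set q : 'I_m | (q <= p)%N]| = p.+1.
  rewrite -sum1_card; under eq_bigl do rewrite inE -ltnS.
  by rewrite -(big_ord_widen _ (fun=> 1%N)) // sum1_card card_ord.
by apply/subset_leq_card/subsetP => q; rewrite !inE => /andP[].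
Qed.

(** * Counting recursions for stopping rules *)

Section StoppingRule.

Variable L : nat -> nat.

(** Positions are zero-based: relative ranks up to [L q] are accepted at time [q.+1]. *)
Definition skipped (m : nat) (pi : 'S_m) : bool :=
  [forall q : 'I_m, L q < relative_rank pi q]%N.

Definition chosen (m : nat) (pi : 'S_m) (p : 'I_m) : bool :=
  ((relative_rank pi p <= L p)
   && [forall q : 'I_m, (q < p) ==> (L q < relative_rank pi q)])%N.

Definition num_skipped (m : nat) : nat := (\sum_(pi : 'S_m) skipped pi)%N.

Definition num_wins (m k : nat) : nat :=
  (\sum_(pi : 'S_m) \sum_(p : 'I_m) (chosen pi p && (rank pi p <= k)%N))%N.

Lemma forall_ord_recr (m : nat) (P : pred 'I_m.+1) :
  [forall p, P p] = [forall p : 'I_m, P (lift ord_max p)] && P ord_max.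
Proof.
apply/forallP/andP => [P_ | [/forallP P_ Pmax] p].
  by split=> //; apply/forallP => p; apply: P_.
by have [q ->|->] := unliftP ord_max p.
Qed.

Lemma skipped_lift (m : nat) (sg : 'S_m) (v : 'I_m.+1) :
  skipped (lift_perm ord_max v sg) = skipped sg && (L m <= v)%N.
Proof.
rewrite /skipped forall_ord_recr relative_rank_ord_max /rank lift_perm_id ltnS.
congr (_ && _); apply: eq_forallb => /= q.
by rewrite relative_rank_lift bump_ord.
Qed.

Lemma chosen_lift (m : nat) (sg : 'S_m) (v : 'I_m.+1) (p : 'I_m) :
  chosen (lift_perm ord_max v sg) (lift ord_max p) = chosen sg p.
Proof.
rewrite /chosen forall_ord_recr relative_rank_lift lift_max /= ltnNge.
rewrite (ltnW (ltn_ord p)) /= andbT; congr (_ && _); apply: eq_forallb => /= q.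
by rewrite relative_rank_lift bump_ord.
Qed.

Lemma chosen_ord_max (m : nat) (sg : 'S_m) (v : 'I_m.+1) :
  chosen (lift_perm ord_max v sg) ord_max = skipped sg && (v < L m)%N.
Proof.
rewrite /chosen forall_ord_recr /= ltnn relative_rank_ord_max /rank.
rewrite lift_perm_id andbT andbC; congr (_ && _); apply: eq_forallb => /= q.
by rewrite relative_rank_lift !bump_ord ltn_ord.
Qed.

Lemma sum_ord_lt (m a : nat) : (\sum_(v < m) (v < a)%N = minn a m)%N.
Proof.
elim: m => [|m IHm]; first by rewrite big_ord0 minn0.
by rewrite big_ord_recr /= IHm; lia.
Qed.

Lemma sum_ord_ge (m a : nat) : (\sum_(v < m) (a <= v)%N = m - a)%N.
Proof.
elim: m => [|m IHm]; first by rewrite big_ord0.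
by rewrite big_ord_recr /= IHm; lia.
Qed.

(** A last rank [v <= r] pushes [r] up by one. So [r < k.-1] stays below [k] for all [m.+1] values
    of [v], and [r = k.-1] only for the [m.+1 - k] values [v > r]. *)
Lemma sum_lift_rank (m k r : nat) : (r < m)%N -> (k <= m.+1)%N ->
  (\sum_(v < m.+1) (bump v r < k)
   = (m.+1 - k) * (r < k) + k * (r < k.-1))%N.
Proof.
move=> lt_rm le_km.
have -> : (\sum_(v < m.+1) (bump v r < k)
           = \sum_(v < m.+1) (if r < k.-1 then 1 else (r < k) * (r < v)))%N.
  by apply: eq_bigr => v _; rewrite /bump; case: ifP; case: ltnP; lia.
have [lt_rk|nlt_rk] := ltnP r k.-1; first by rewrite sum1_card card_ord; lia.
have [lt_rk|le_kr] := ltnP r k; last first.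
  by rewrite big1 => [|v _]; lia.
transitivity (\sum_(v < m.+1) (r < v))%N; first by apply: eq_bigr => v _; lia.
by rewrite sum_ord_ge; lia.
Qed.

Lemma num_skipped0 : num_skipped 0 = 1%N.
Proof.
rewrite /num_skipped (eq_bigr (fun=> 1%N)); last first.
  by move=> pi _; apply/eqP; rewrite eqb1; apply/forallP => -[].
by rewrite sum1_card card_Sn.
Qed.

(** The last rank is independent of the earlier order and is rejected iff [L m <= v]; truncated
    subtraction gives 0 when [L m] exceeds [m.+1]. *)
Lemma num_skippedS (m : nat) :
  num_skipped m.+1 = ((m.+1 - L m) * num_skipped m)%N.
Proof.
rewrite /num_skipped sum_perm_lift big_distrr /=; apply: eq_bigr => sg _.
under eq_bigr do rewrite skipped_lift -mulnb.
rewrite -big_distrr mulnC /=; congr (_ * _)%N.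
exact: sum_ord_ge.
Qed.

Lemma num_wins0 (k : nat) : num_wins 0 k = 0%N.
Proof. by rewrite /num_wins big1 // => pi _; rewrite big_ord0. Qed.

Lemma sum_ord_recr_lift (m : nat) (f : 'I_m.+1 -> nat) :
  (\sum_p f p = \sum_(p < m) f (lift ord_max p) + f ord_max)%N.
Proof.
rewrite big_ord_recr /=; congr (_ + _)%N; apply: eq_bigr => p _.
by congr f; apply/val_inj; rewrite /= bump_ord.
Qed.

(** An earlier choice wins if it was among the [k] best and the newcomer is not, or if it was among
    the [k.-1] best and the newcomer takes one of the [k] best ranks. The last summand counts wins
    by the newcomer. *)
Lemma num_winsS (m k : nat) : (k <= m.+1)%N ->
  num_wins m.+1 k = ((m.+1 - k) * num_wins m k + k * num_wins m k.-1
                     + minn k (minn (L m) m.+1) * num_skipped m)%N.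
Proof.
move=> le_km; rewrite /num_wins /num_skipped sum_perm_lift !big_distrr /=.
rewrite -!big_split /=; apply: eq_bigr => sg _.
under eq_bigr do rewrite sum_ord_recr_lift.
rewrite big_split exchange_big /= !big_distrr -big_split /=; congr (_ + _)%N.
  apply: eq_bigr => p _.
  under eq_bigr do rewrite chosen_lift /rank lift_perm_lift -mulnb.
  rewrite -big_distrr /= sum_lift_rank // /rank.
  have -> : ((sg p).+1 <= k.-1)%N = (sg p < k.-1)%N by [].
  by case: (chosen sg p); lia.
under eq_bigr do rewrite chosen_ord_max /rank lift_perm_id -andbA -mulnb.
rewrite -big_distrr /= mulnC; congr (_ * _)%N.
rewrite minnA -sum_ord_lt; apply: eq_bigr => v _.
by rewrite leq_min andbC.
Qed.

End StoppingRule.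

(** * Hypergeometric means and the success probability *)

Section Hypergeometric.

Variable R : realFieldType.
Implicit Type f : nat -> R.

(** For [k <= n] this is ['C(n, i)] times the expectation of [f] at the number of the [k] best in a
    uniform [i]-sample. *)
Definition hyper_sum (n k i : nat) f : R :=
  \sum_(x < i.+1) f x * ('C(k, x) * 'C(n - k, i - x))%:R.

Definition hyper_mean_min (n k i l : nat) : R :=
  hyper_sum n k i (fun x => (minn l x)%:R) / 'C(n, i)%:R.

Lemma bin_natr_neq0 (n i : nat) : (i <= n)%N -> 'C(n, i)%:R != 0 :> R.
Proof. by move=> le_in; rewrite pnatr_eq0 -lt0n bin_gt0. Qed.

Lemma fact_natr_neq0 (n : nat) : n`!%:R != 0 :> R.
Proof. by rewrite pnatr_eq0 -lt0n fact_gt0. Qed.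

Lemma hyper_sum1 (n k i : nat) : (k <= n)%N ->
  hyper_sum n k i (fun=> 1) = 'C(n, i)%:R.
Proof.
move=> le_kn; rewrite /hyper_sum -[in RHS](subnKC le_kn) -binomial.Vandermonde.
by rewrite natr_sum; apply: eq_bigr => x _; rewrite mul1r.
Qed.

Lemma hyper_sum_full (n k : nat) f : (k <= n)%N -> hyper_sum n k n f = f k.
Proof.
move=> le_kn; have lt_kn : (k < n.+1)%N by [].
rewrite /hyper_sum (bigD1 (Ordinal lt_kn)) //= binn binn mulr1 big1 ?addr0 //.
move=> x; rewrite -val_eqE /= => neq_xk.
have [lt_kx|le_xk] := ltnP k x; first by rewrite bin_small // mulr0.
have lt_nx : (n - k < n - x)%N by lia.
by rewrite (bin_small lt_nx) muln0 mulr0.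
Qed.

(** Double counting of pairs of an [i]-sample and a candidate outside it: deleting that candidate
    leaves the sample intact and [k] or [k.-1] good candidates in the population. *)
Lemma hyper_sumS_population (n k i : nat) f : (k <= n.+1)%N ->
  (n.+1 - i)%:R * hyper_sum n.+1 k i f
  = (n.+1 - k)%:R * hyper_sum n k i f + k%:R * hyper_sum n k.-1 i f.
Proof.
move=> le_kn; rewrite /hyper_sum !big_distrr -big_split /=.
apply: eq_bigr => -[x /= lt_xi] _; rewrite !(mulrCA _ (f x)) -mulrDr.
congr (_ * _); rewrite -!natrM -natrD; congr (_%:R).
have eq_k := mul_bin_down k x.
have := mul_bin_down (n.+1 - k) (i - x).
have -> : ((n.+1 - k).-1 = n - k)%N by lia.
case: k le_kn eq_k => [|k] le_kn eq_k eq_nk.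
  rewrite mul0n addn0; case: x lt_xi {eq_k} eq_nk => [|x] lt_xi eq_nk.
    by rewrite bin0 !mul1n eq_nk; congr (_ * _)%N; lia.
  by rewrite bin0n !mul0n !muln0.
rewrite /= in eq_k; rewrite subSS in eq_nk *; rewrite /=.
rewrite (mulnCA (n - k)%N) eq_nk (mulnA k.+1) eq_k.
have [lt_kx|le_xk] := ltnP k.+1 x; first by rewrite bin_small ?mul0n ?muln0.
have [lt_nx|le_nx] := ltnP (n - k) (i - x).
  by rewrite (bin_small lt_nx) !muln0.
rewrite mulnCA (mulnC _ 'C(k.+1, x)) -mulnA -mulnDr -mulnDl.
by congr (_ * (_ * _))%N; lia.
Qed.

(** Double counting of the ways to enlarge an [i]-sample by one: conversely, dropping an element of
    an [i.+1]-sample with [x] good ones leaves [x.-1] good ones in [x] cases and [x] in the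
    others. *)
Lemma hyper_sumS_sample (n k i : nat) f : (k <= n)%N ->
  (n - i)%:R * hyper_sum n k i f
  = hyper_sum n k i.+1 (fun x => x%:R * f x.-1 + (i.+1 - x)%:R * f x).
Proof.
move=> le_kn; rewrite /hyper_sum.
under [RHS]eq_bigr do rewrite mulrDl.
rewrite big_split /= [X in _ = X + _]big_ord_recl /= !mul0r add0r.
rewrite [X in _ = _ + X]big_ord_recr /= subnn !mul0r addr0.
rewrite big_distrr -big_split.
apply: eq_bigr => -[x /= lt_xi] _; rewrite /bump /= add1n subSS.
rewrite ![in RHS](mulrC _ (f x)) -!(mulrA (f x)) mulrCA -mulrDr.
congr (_ * _); rewrite -!natrM -natrD; congr (_%:R).
rewrite (mulnA x.+1) mul_bin_left subSn // (mulnCA (i - x).+1) mul_bin_left.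
have [lt_kx|le_xk] := ltnP k x; first by rewrite bin_small ?mul0n ?muln0.
have [lt_nx|le_nx] := ltnP (n - k) (i - x).
  by rewrite (bin_small lt_nx) !muln0.
rewrite (mulnCA _ (n - k - _)%N) -mulnA -mulnDl.
by congr (_ * _)%N; lia.
Qed.

Lemma win_probability (L : nat -> nat) (n k : nat) : (k <= n)%N ->
  (num_wins L n k)%:R / n`!%:R
  = \sum_(i < n) (num_skipped L i)%:R / i.+1`!%:R
                 * hyper_mean_min n k i.+1 (L i).
Proof.
elim: n k => [|n IHn] k le_kn; first by rewrite num_wins0 big_ord0 mul0r.
have nzS : n.+1%:R != 0 :> R by rewrite pnatr_eq0.
have nzf := fact_natr_neq0 n.
(* The factor [n.+1 - k] absorbs the case [k = n.+1], which the induction hypothesis does not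
   cover. *)
have IHk : (n.+1 - k)%:R * ((num_wins L n k)%:R / n`!%:R)
           = (n.+1 - k)%:R * \sum_(i < n) (num_skipped L i)%:R / i.+1`!%:R
                 * hyper_mean_min n k i.+1 (L i).
  have [le_kn'|lt_nk] := leqP k n; first by rewrite IHn.
  by rewrite (_ : n.+1 - k = 0)%N ?mul0r //; lia.
have IHk1 := IHn k.-1 ltac:(lia).
rewrite big_ord_recr /= num_winsS // {2}/hyper_mean_min hyper_sum_full //.
rewrite binn invr1 mulr1 factS (natrM _ n.+1) !natrD !natrM.
have -> : minn k (minn (L n) n.+1) = minn (L n) k by lia.
transitivity ((n.+1%:R^-1 : R) * ((n.+1 - k)%:R * ((num_wins L n k)%:R / n`!%:R)
   + k%:R * ((num_wins L n k.-1)%:R / n`!%:R))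
   + (num_skipped L n)%:R / (n.+1%:R * n`!%:R) * (minn (L n) k)%:R).
  move: nzS nzf; move: (n.+1%:R) (n`!%:R) => a b nza nzb.
  by field; rewrite nza nzb.
congr (_ + _); rewrite IHk IHk1 !big_distrr -big_split big_distrr /=.
apply: eq_bigr => i _; rewrite !(mulrCA _ (_ / _)) -mulrDr mulrCA.
congr (_ * _).
rewrite /hyper_mean_min !mulrA -mulrDl -hyper_sumS_population //.
have nz1 := bin_natr_neq0 (ltn_ord i).
have nz2 : 'C(n.+1, i.+1)%:R != 0 :> R.
  by apply: bin_natr_neq0; rewrite ltnS ltnW.
(* This identity changes the normalization from ['C(n, i.+1)] to ['C(n.+1, i.+1)]. *)
have := congr1 (fun x => x%:R : R) (mul_bin_down n.+1 i.+1); rewrite !natrM /=.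
move=> eq_bin; apply: (mulfI nzS); rewrite mulVKf //.
by apply/eqP; rewrite mulrA eqr_div // mulrAC -eq_bin mulrAC.
Qed.

End Hypergeometric.

(** * The policy as a stopping rule *)

Section Policy.

Variables (n k : nat) (s : nat -> nat).
Hypothesis hs : forall l : nat, (1 <= l <= k)%N -> (l <= s l < n)%N.
Hypothesis hmono : forall l m : nat,
  (1 <= l)%N -> (l <= m)%N -> (m <= k)%N -> (s l <= s m)%N.

(* Accepting every last candidate accounts for the default choice of the
   policy. *)
Definition level (p : nat) : nat :=
  if p.+1 == n then n else (\max_(l < k.+1 | (0 < l) && (s l <= p)) l)%N.

Lemma threshold_lt (l : nat) : (1 <= l <= k.+1)%N -> (0 < n)%N ->
  (threshold n k s l < n)%N.
Proof.
rewrite /threshold => /andP[l_gt0 le_lk] n_gt0; case: eqP => [_|/eqP neq_lk].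
  by rewrite prednK.
by have /andP[] : (l <= s l < n)%N by apply: hs; lia.
Qed.

(** Index [p] is time [p.+1], so s_l < time <= s_{l+1} reads [s l <= p < s l.+1]; monotonicity then
    excludes every larger index from the maximum. *)
Lemma levelE (l p : nat) : (l <= k)%N -> (p.+1 < n)%N ->
  (0 < l -> s l <= p)%N -> (p < threshold n k s l.+1)%N -> level p = l.
Proof.
move=> le_lk lt_pn ge_p lt_p; rewrite /level ltn_eqF //; apply/eqP.
rewrite eqn_leq; apply/andP; split.
  apply/bigmax_leqP => -[l' /= lt_l'k] /andP[l'_gt0 ge_p'].
  rewrite leqNgt; apply/negP => lt_ll'.
  move: lt_p; rewrite /threshold ltn_eqF; last by lia.
  by rewrite ltnNge (leq_trans _ ge_p') // hmono.
case: (posnP l) => [-> //|l_gt0].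
have lt_lk : (l < k.+1)%N by [].
apply: (@leq_bigmax_cond _ _ (fun l : 'I_k.+1 => nat_of_ord l) (Ordinal lt_lk)).
by rewrite /= l_gt0 ge_p.
Qed.

Lemma level_bounds (p : nat) : (p.+1 < n)%N ->
  [/\ level p <= k, 0 < level p -> s (level p) <= p
    & p < threshold n k s (level p).+1]%N.
Proof.
move=> lt_pn.
have [l [le_lk ge_p lt_p]] : exists l, [/\ l <= k, 0 < l -> s l <= p
    & p < threshold n k s l.+1]%N.
  have ex_l : exists l, (p < threshold n k s l.+1)%N.
    by exists k; rewrite /threshold eqxx; lia.
  (* The level is the least [l] with [p] below the next threshold; minimality gives [s l <= p]. *)
  case: (ex_minnP ex_l) => l lt_p min_l; exists l; split=> //.
    by apply: min_l; rewrite /threshold eqxx; lia.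
  case: l lt_p min_l => // l lt_p min_l _; rewrite leqNgt; apply/negP => lt_p'.
  have le_lk : (l.+1 <= k)%N by apply: min_l; rewrite /threshold eqxx; lia.
  suff : (l.+1 <= l)%N by rewrite ltnn.
  by apply: min_l; rewrite /threshold ltn_eqF //; lia.
by rewrite (levelE le_lk).
Qed.

Lemma acceptable_level (pi : 'S_n) (p : 'I_n) : (p.+1 < n)%N ->
  acceptable k s pi p = (relative_rank pi p <= level p)%N.
Proof.
move=> lt_pn; apply/existsP/idP.
  move=> [[l /= lt_lk] /and3P[l_gt0 /andP[ge_p lt_p] le_rl]].
  rewrite (@levelE l) // => _; move: ge_p.
  by rewrite /threshold ltn_eqF // ltnS.
have [le_lk ge_p lt_p] := level_bounds lt_pn => le_r.
(* At level 0 nothing is accepted, as relative ranks are positive. *)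
have l_gt0 := leq_trans (relative_rank_gt0 pi p) le_r.
have lt_lk : (level p < k.+1)%N by [].
exists (Ordinal lt_lk); rewrite /= l_gt0 lt_p le_r !andbT /=.
by rewrite /threshold ltn_eqF // ltnS ge_p.
Qed.

(** All thresholds are at most [n.-1], so time [n] lies in none of the intervals and is reached only
    by default. *)
Lemma acceptable_last (pi : 'S_n) (p : 'I_n) : p.+1 = n ->
  acceptable k s pi p = false.
Proof.
move=> eq_pn; apply/negbTE/existsP.
move=> -[[l lt_lk] /= /and3P[l_gt0 /andP[_ lt_p] _]].
by have := @threshold_lt l.+1 ltac:(lia) ltac:(lia); lia.
Qed.

Lemma selects_chosen (pi : 'S_n) (p : 'I_n) :
  selects k s pi p = chosen level pi p.
Proof.
have eq_before : [forall q : 'I_n, (q < p)%N ==> ~~ acceptable k s pi q]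
    = [forall q : 'I_n, (q < p)%N ==> (level q < relative_rank pi q)%N].
  apply: eq_forallb => q; case: ltnP => //= lt_qp.
  by rewrite (acceptable_level _ (leq_ltn_trans lt_qp (ltn_ord p))) ltnNge.
rewrite /selects /chosen -eq_before; have := ltn_ord p.
rewrite leq_eqVlt => /predU1P[eq_pn|lt_pn]; last first.
  by rewrite acceptable_level // (ltn_eqF lt_pn) orbF.
rewrite acceptable_last // eq_pn eqxx /= /level eq_pn eqxx.
(* The level [n] at the last position accepts every relative rank, which is the default choice. *)
have -> /= : (relative_rank pi p <= n)%N.
  by rewrite -[X in (_ <= X)%N]eq_pn relative_rank_le.
apply: eq_forallb => q; have [lt_qp|le_pq] //= := ltnP q p.
have eq_qp : q = p by apply/val_inj => /=; have := ltn_ord q; lia.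
by rewrite eq_qp acceptable_last.
Qed.

Lemma chosen_inj (L : nat -> nat) (pi : 'S_n) (p q : 'I_n) :
  chosen L pi p -> chosen L pi q -> p = q.
Proof.
move=> /andP[rp /forallP before_p] /andP[rq /forallP before_q].
have := before_p q; have := before_q p.
rewrite (ltnNge (L p)) rp (ltnNge (L q)) rq !implybF -!leqNgt => le_qp le_pq.
by apply/val_inj/eqP; rewrite eqn_leq le_pq le_qp.
Qed.

(** At most one position is chosen, so the existential in [success] becomes a sum of indicators. *)
Lemma card_success :
  #|[set pi : 'S_n | success k s pi]| = num_wins level n k.
Proof.
rewrite -sum1_card big_mkcond; apply: eq_bigr => pi _; rewrite inE.
transitivity (success k s pi : nat); first by case: (success _ _ _).
rewrite /success; case: existsP => [[p /andP[]]|no_p].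
  rewrite selects_chosen => sel_p le_pk.
  rewrite (bigD1 p) //= sel_p le_pk big1 // => q neq_qp.
  apply/eqP; rewrite eqb0; apply: contra neq_qp => /andP[sel_q _].
  exact/eqP/(chosen_inj sel_q sel_p).
rewrite big1 // => p _; apply/eqP; rewrite eqb0; apply/negP => sel_p.
by apply: no_p; exists p; rewrite selects_chosen.
Qed.

End Policy.

(** * Antiderivatives of the summands between thresholds *)

Section Antiderivatives.

Variables (R : realFieldType) (n k : nat).
Hypothesis hk : (1 <= k < n)%N.

Let le_kn : (k <= n)%N. Proof. by lia. Qed.

Local Notation M := (hyper_mean_min R n k).

Lemma natr_neq0 (m : nat) : (0 < m)%N -> m%:R != 0 :> R.
Proof. by rewrite pnatr_eq0 lt0n. Qed.

Lemma bin_natrE (m j : nat) : (j <= m)%N ->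
  'C(m, j)%:R = m`!%:R / (j`!%:R * (m - j)`!%:R) :> R.
Proof.
move=> le_jm; rewrite -(bin_fact le_jm) !natrM mulfK //.
by rewrite mulf_neq0 ?fact_natr_neq0.
Qed.

Lemma hyper_sumZ (i : nat) (c : R) (f : nat -> R) :
  hyper_sum n k i (fun x => c * f x) = c * hyper_sum n k i f.
Proof.
by rewrite /hyper_sum big_distrr; apply: eq_bigr => x _; rewrite /= mulrA.
Qed.

Lemma hyper_sumD (i : nat) (f g : nat -> R) :
  hyper_sum n k i (fun x => f x + g x) = hyper_sum n k i f + hyper_sum n k i g.
Proof.
by rewrite /hyper_sum -big_split; apply: eq_bigr => x _; rewrite /= mulrDl.
Qed.

Lemma eq_hyper_sum (i : nat) (f g : nat -> R) :
  (forall x, (x <= i)%N -> f x = g x) -> hyper_sum n k i f = hyper_sum n k i g.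
Proof. by move=> eq_fg; apply: eq_bigr => -[x lt_xi] _ /=; rewrite eq_fg. Qed.

Lemma hyper_mean_min0 (i : nat) : M i 0 = 0.
Proof.
rewrite /hyper_mean_min /hyper_sum big1 ?mul0r // => x _.
by rewrite min0n mul0r.
Qed.

(** Both sides count disjoint pairs of an [i]-subset and a [k]-subset. *)
Lemma bin_trinomial (i : nat) :
  ('C(n, i) * 'C(n - i, k) = 'C(n, k) * 'C(n - k, i))%N.
Proof.
have [le_ikn|lt_nik] := leqP (i + k) n; last first.
  rewrite !(@bin_small (n - _)) ?muln0 //; lia.
have e_n := @bin_fact n i ltac:(lia).
have e_ni := @bin_fact (n - i) k ltac:(lia).
have e_n' := @bin_fact n k ltac:(lia).
have e_nk := @bin_fact (n - k) i ltac:(lia).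
have : (0 < k`! * i`! * (n - i - k)`!)%N by rewrite !muln_gt0 !fact_gt0.
move=> gt0; apply/eqP; rewrite -(eqn_pmul2r gt0); apply/eqP.
transitivity n`!; first by rewrite -e_n -e_ni; nia.
by rewrite -e_n' -e_nk (_ : n - i - k = n - k - i)%N; nia.
Qed.

(** The minimum with 1 is the indicator that the sample meets the [k] best; the complement has
    probability ['C(n - k, i) / 'C(n, i)], rewritten by [bin_trinomial]. *)
Lemma hyper_mean_min1 (i : nat) : (i <= n)%N ->
  M i 1 = 1 - 'C(n - i, k)%:R / 'C(n, k)%:R.
Proof.
move=> le_in; rewrite /hyper_mean_min.
have -> : hyper_sum n k i (fun x => (minn 1 x)%:R)
          = 'C(n, i)%:R - 'C(n - k, i)%:R :> R.
  rewrite -(hyper_sum1 R i le_kn) /hyper_sum !big_ord_recl /= minn0 bin0 subn0.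
  rewrite !mul1r mul1n mul0r add0r. rewrite [RHS]addrAC subrr add0r.
  by apply: eq_bigr => x _; rewrite (minn_idPl _) // mul1r.
have nzi := bin_natr_neq0 R le_in; have nzk := bin_natr_neq0 R le_kn.
have := congr1 (fun x => x%:R : R) (bin_trinomial i); rewrite !natrM => eq_bin.
rewrite mulrBl mulfV //; congr (_ - _); apply/eqP.
by rewrite eqr_div // mulrC -eq_bin mulrC.
Qed.

(* Dropping a uniform element of a sample of size [i.+1] gives one of size [i],
   and [x min(l, x-1) + (l+1-x) min(l, x) = l min(l+1, x)]. *)
Lemma hyper_mean_minS (i l : nat) : (i < n)%N -> (l <= i)%N ->
  i.+1%:R * M i l = l%:R * M i.+1 l.+1 + (i - l)%:R * M i.+1 l.
Proof.
move=> lt_in le_li.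
have eq_sum : (n - i)%:R * hyper_sum n k i (fun x => (minn l x)%:R)
    = l%:R * hyper_sum n k i.+1 (fun x => (minn l.+1 x)%:R)
      + (i - l)%:R * hyper_sum n k i.+1 (fun x => (minn l x)%:R) :> R.
  rewrite hyper_sumS_sample // -!hyper_sumZ -hyper_sumD; apply: eq_hyper_sum.
  move=> x le_xi; rewrite -!natrM -!natrD; congr (_%:R).
  case: x le_xi => [|x] le_xi /=; first by rewrite !minn0 !muln0.
  have [lt_xl|le_lx] : (x < l \/ l <= x)%N by lia.
    have [-> -> ->] : [/\ minn l x = x, minn l x.+1 = x.+1
                       & minn l.+1 x.+1 = x.+1].
      by split; lia.
    by rewrite (mulnC x.+1) -!mulnDl; congr (_ * _)%N; lia.
  have [-> -> ->] : [/\ minn l x = l, minn l x.+1 = l & minn l.+1 x.+1 = l.+1].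
    by split; lia.
  by rewrite (mulnC l) -!mulnDl; congr (_ * _)%N; lia.
have := congr1 (fun x => x%:R : R) (mul_bin_left n i); rewrite !natrM => eq_bin.
have nz1 := bin_natr_neq0 R lt_in; have nz0 := bin_natr_neq0 R (ltnW lt_in).
rewrite /hyper_mean_min !mulrA -mulrDl -eq_sum; apply/eqP.
by rewrite eqr_div // mulrAC eq_bin mulrAC.
Qed.

(** For [x < n] every upper argument is nonnegative, so [binz] becomes the ordinary binomial. *)
Lemma d0E (x : nat) : (x < n)%N ->
  d R n k 0 x = - 1 + k%:R * x%:R / n%:R + 'C(n - x - 1, k)%:R / 'C(n, k)%:R
    + x%:R / 'C(n, k)%:R
      * \sum_(1 <= j < x.+1) 'C(n - j - 1, k - 1)%:R / j%:R.
Proof.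
move=> lt_xn; rewrite /d binzE.
have -> : n%:Z - x%:Z - 1 = (n - x - 1)%N%:Z by lia.
rewrite binzE; congr (_ + _ * _); apply: eq_big_nat => j lt_j.
have -> : n%:Z - j%:Z - 1 = (n - j - 1)%N%:Z by lia.
have -> : k%:Z - 1 = (k - 1)%N%:Z by lia.
by rewrite binzE.
Qed.

Lemma d1E (x : nat) : (x < n)%N ->
  d R n k 1 x = - (k%:R / n%:R) - 'C(n, k)%:R^-1
      * \sum_(1 <= j < x.+1) 'C(n - j - 1, k - 1)%:R / j%:R.
Proof.
move=> lt_xn; rewrite /d binzE.
congr (_ - _ * _); apply: eq_big_nat => j lt_j.
have -> : n%:Z - j%:Z - 1 = (n - j - 1)%N%:Z by lia.
have -> : k%:Z - 1 = (k - 1)%N%:Z by lia.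
by rewrite binzE.
Qed.

Lemma dSSE (l x : nat) : (0 < x)%N ->
  d R n k l.+2 x = (k%:R * x`!%:R * (n - l.+2 - x)`!%:R)
                   / (l.+2%:R * l.+1%:R * n`!%:R)
      * \sum_(j < l.+1) ('C(k - 1, j) * 'C(n - k, x + l.+1 - j))%:R.
Proof.
move=> x_gt0; rewrite /d.
have -> : l.+2%:R - 1 = l.+1%:R :> R by rewrite -[l.+2]addn1 natrD addrK.
congr (_ * _); rewrite big_mkord; apply: eq_bigr => -[j /= lt_jl] _.
have -> : k%:Z - 1 = (k - 1)%N%:Z by lia.
have -> : n%:Z - k%:Z = (n - k)%N%:Z by lia.
have -> : x%:Z + l.+2%:Z - j%:Z - 1 = (x + l.+1 - j)%N%:Z by lia.
by rewrite !binzE natrM.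
Qed.

(* [T_l * gain l i], with [T_l] the product of the first [l] numbers [t_j], is
   up to an additive constant the contribution of the first [i] candidates when
   [i] lies between the thresholds [s_l] and [s_{l+1}]. *)
Definition gain (l i : nat) : R :=
  match l with
  | 0 => 0
  | 1 => d R n k 0 i / i%:R
  | l'.+1 => - ((i - l)`!%:R / i`!%:R * M i l' / l'%:R)
  end.

(** The right side is the summand of [win_probability] divided by T_l. For [l = 1] Pascal's rule
    matches the new term of the sum in d_0; for larger [l] the increment is [hyper_mean_minS]. *)
Lemma gain_step (l i : nat) : (l <= i)%N -> (i.+1 < n)%N ->
  gain l i.+1 - gain l i = (i - l)`!%:R / i.+1`!%:R * M i.+1 l.
Proof.
case: l => [|[|l]] le_li lt_in.
- by rewrite hyper_mean_min0 subrr mulr0.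
- rewrite /gain !d0E; try lia.
  rewrite hyper_mean_min1; last by lia.
  rewrite (big_nat_recr i.+1) //=; set S := \sum_(_ <= _ < _) _.
  have -> : (n - i - 1 = n - i.+1)%N by lia.
  have -> : (n - i.+1 - 1 = (n - i.+1).-1)%N by lia.
  have -> : 'C(n - i.+1, k)%:R = 'C((n - i.+1).-1, k)%:R
              + 'C((n - i.+1).-1, k - 1)%:R :> R.
    have : (0 < n - i.+1)%N by lia.
    case: (n - i.+1)%N => // m _; case: k hk => // k' _.
    by rewrite binS natrD subn1 addrC.
  have nzk := bin_natr_neq0 R le_kn.
  have nzn : n%:R != 0 :> R by apply: natr_neq0; lia.
  have nzi : i%:R != 0 :> R by apply: natr_neq0.
  have nzi1 : i.+1%:R != 0 :> R by apply: natr_neq0.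
  have -> : (i - 1)`!%:R / i.+1`!%:R = (i.+1%:R * i%:R)^-1 :> R.
    rewrite subn1 factS natrM -{3}(prednK le_li) factS natrM prednK //.
    by rewrite mulrA invfM mulrCA mulfV ?mulr1 ?fact_natr_neq0.
  have Ei : i.+1%:R = i%:R + 1 :> R by rewrite -addn1 natrD.
  rewrite Ei in nzi1 *; field.
  by rewrite nzk nzn nzi nzi1.
have := @hyper_mean_minS i l.+1 ltac:(lia) ltac:(lia).
rewrite /gain; set Mi := M i _; set Mi1 := M i.+1 l.+1; set Mi1' := M _ _.
have -> : (i.+1 - l.+2 = (i - l.+2).+1)%N by lia.
have -> : (i - l.+1 = (i - l.+2).+1)%N by lia.
rewrite !factS !natrM.
have nzi1 : i.+1%:R != 0 :> R by apply: natr_neq0.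
have nzl1 : l.+1%:R != 0 :> R by apply: natr_neq0.
have nzf := fact_natr_neq0 R i.
move: nzi1 nzl1 nzf.
move: (i.+1%:R) (l.+1%:R) (i`!%:R) ((i - l.+2).+1%:R) ((i - l.+2)`!%:R).
move=> a b c e f nza nzb nzc eqM.
have -> : Mi = (b * Mi1' + e * Mi1) / a by rewrite -eqM mulrC mulKf.
by field; rewrite nza nzb nzc.
Qed.

(** At the threshold i = s_{l+1} the product gains the factor t_{l+1} = i - l; thus d_l is the jump,
    up to T_l, caused by changing the antiderivative. *)
Lemma gain_switch (l i : nat) : (l < k)%N -> (l < i)%N -> (i < n)%N ->
  (i - l)%:R * gain l.+1 i - gain l i = d R n k l (i - l).
Proof.
case: l => [|[|l]] lt_lk lt_li lt_in.
- by rewrite /gain subn0 subr0 mulrC divfK // natr_neq0.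
- rewrite /gain d0E // d1E; last by lia.
  rewrite hyper_mean_min1; last by lia.
  have -> : (i - 1).+1 = i by lia.
  rewrite big_nat_recr //=; last by lia.
  set S := \sum_(_ <= _ < _) _.
  have -> : (n - i - 1 = (n - i).-1)%N by lia.
  have -> : 'C(n - i, k)%:R = 'C((n - i).-1, k)%:R
              + 'C((n - i).-1, k - 1)%:R :> R.
    have : (0 < n - i)%N by lia.
    case: (n - i)%N => // m _; case: k hk => // k' _.
    by rewrite binS natrD subn1 addrC.
  have nzk := bin_natr_neq0 R le_kn.
  have nzn : n%:R != 0 :> R by apply: natr_neq0; lia.
  have nzi : i%:R != 0 :> R by apply: natr_neq0; lia.
  have nzi1 : (i - 1)%:R != 0 :> R by apply: natr_neq0; lia.
  have Ei : i = (i - 1).+1 by lia.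
  have -> : (i - 2)`!%:R / i`!%:R = (i%:R * (i - 1)%:R)^-1 :> R.
    rewrite [in i`!]Ei factS natrM -Ei; have -> : (i - 1 = (i - 2).+1)%N by lia.
    by rewrite factS natrM mulrA invfM mulrCA mulfV ?mulr1 ?fact_natr_neq0.
  have {}Ei : (i - 1)%:R = i%:R - 1 :> R by rewrite natrB //; lia.
  rewrite Ei in nzi1 *; field.
  by rewrite nzk nzn nzi nzi1.
rewrite dSSE /gain /hyper_mean_min; last by lia.
have -> : (n - l.+2 - (i - l.+2) = n - i)%N by lia.
have le_in := ltnW lt_in.
(* The combination of the two minima is [x] for [x < l.+2] and 0 afterwards, which truncates the
   sum; then [x * 'C(k, x) = k * 'C(k - 1, x - 1)]. *)
have eq_sum : l.+2%:R * hyper_sum n k i (fun x => (minn l.+1 x)%:R)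
   - l.+1%:R * hyper_sum n k i (fun x => (minn l.+2 x)%:R)
   = k%:R * \sum_(j < l.+1)
       ('C(k - 1, j) * 'C(n - k, i - l.+2 + l.+1 - j))%:R :> R.
  rewrite -mulNr -!hyper_sumZ -hyper_sumD.
  rewrite (@eq_hyper_sum _ _ (fun x => if (x < l.+2)%N then x%:R else 0));
    last first.
    move=> x _; rewrite mulNr; apply/eqP; rewrite subr_eq; case: ltnP => lt_xl.
      rewrite -!natrM -natrD; apply/eqP; congr (_%:R).
      by rewrite /minn; do !case: ifP => ?; nia.
    rewrite add0r -!natrM; apply/eqP; congr (_%:R).
    by rewrite /minn; do !case: ifP => ?; nia.
  rewrite /hyper_sum big_ord_recl /= mul0r add0r big_distrr /=.
  have le_l : (l.+1 <= i)%N by lia.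
  rewrite (big_ord_widen _ (fun j =>
    k%:R * ('C(k - 1, j) * 'C(n - k, i - l.+2 + l.+1 - j))%:R) le_l).
  rewrite [RHS]big_mkcond; apply: eq_bigr => -[x /= lt_xi] _.
  rewrite /bump /= add1n ltnS; case: ltnP => lt_xl; last by rewrite mul0r.
  have -> : (i - l.+2 + l.+1 - x = i - x.+1)%N by lia.
  by rewrite -!natrM !mulnA -mul_bin_diag subn1.
have nzi := fact_natr_neq0 R i; have nzni := fact_natr_neq0 R (n - i).
have nzn := fact_natr_neq0 R n.
have nzl1 : l.+1%:R != 0 :> R by apply: natr_neq0.
have nzl2 : l.+2%:R != 0 :> R by apply: natr_neq0.
have -> : (i - l.+2)`! = ((i - l.+2) * (i - l.+3)`!)%N.
  by have -> : (i - l.+2 = (i - l.+3).+1)%N by lia.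
rewrite bin_natrE // natrM.
move: eq_sum; set H1 := hyper_sum _ _ _ _; set H2 := hyper_sum _ _ _ _.
set S := \sum_(_ < _) _.
move: nzi nzni nzn nzl1 nzl2.
move: (i`!%:R) ((n - i)`!%:R) (n`!%:R) (l.+1%:R) (l.+2%:R) (k%:R).
move: ((i - l.+2)%:R) ((i - l.+3)`!%:R).
move=> a b c e f g h q nzc nze nzf nzg nzh eqS.
have -> : H1 = (q * S + g * H2) / h.
  by rewrite -eqS subrK mulrC mulKf.
by field; rewrite nzc nze nzf nzg nzh.
Qed.

(** The second summand is, up to T_k, the contribution of time [n], where any candidate is accepted
    and the mean of the minimum is [k]. *)
Lemma gain_last :
  gain k n.-1 + (n.-1 - k)`!%:R / n`!%:R * k%:R = - delta R k n.
Proof.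
rewrite /delta; case: eqP => [k1|/eqP neq_k1].
  have nzn : n%:R != 0 :> R by apply: natr_neq0; lia.
  have nzn1 : n.-1%:R != 0 :> R by apply: natr_neq0; lia.
  have En : n = n.-1.+1 by lia.
  rewrite k1 /gain -k1 d0E; last by lia.
  rewrite opprK k1 (@bin_small (n - n.-1 - 1)) ?bin1; last by lia.
  have -> : (n.-1 - 1)`!%:R / n`!%:R = (n%:R * n.-1%:R)^-1 :> R.
    rewrite [in n`!]En factS natrM -En.
    have -> : (n.-1 = (n.-1 - 1).+1)%N by lia.
    rewrite factS natrM subn1 /=.
    by rewrite mulrA invfM mulrCA mulfV ?mulr1 ?fact_natr_neq0.
  rewrite -En; under eq_bigr do rewrite subnn bin0 div1r.
  set S := \sum_(_ <= _ < _) _.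
  have {}En : n.-1%:R = n%:R - 1 :> R by rewrite -subn1 natrB //; lia.
  rewrite En in nzn1 *; field.
  by rewrite nzn nzn1.
have [l Ek] : exists l, k = l.+2 by exists k.-2; lia.
(* A sample of size [n.-1] misses one candidate, so it contains at least [k - 1 = l.+1] of the
   best. *)
have eq_M : M n.-1 l.+1 = l.+1%:R.
  have nzn : n%:R != 0 :> R by apply: natr_neq0; lia.
  have := @hyper_mean_minS n.-1 l.+1 ltac:(lia) ltac:(lia).
  rewrite !prednK; try lia.
  rewrite /hyper_mean_min !hyper_sum_full // binn !divr1 => eq_M.
  apply: (mulfI nzn); rewrite eq_M -!natrM -natrD; congr (_%:R).
  by rewrite !(minn_idPl _) ?Ek // mulnC -mulnDl; congr (_ * _)%N; lia.
have nzl : l.+1%:R != 0 :> R by apply: natr_neq0.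
rewrite {1}Ek /gain eq_M mulfK //.
have -> : (n.-1 - l.+2 = n.-1 - k)%N by lia.
have -> : (n - k = (n.-1 - k).+1)%N by lia.
have -> : n`! = (n * n.-1`!)%N by rewrite -{1 2}(@prednK n) //; lia.
have nzn : n%:R != 0 :> R by apply: natr_neq0; lia.
rewrite factS !natrM; have -> : (n.-1 - k).+1%:R = n%:R - k%:R :> R.
  by rewrite -natrB //; congr (_%:R); lia.
field.
by rewrite nzn fact_natr_neq0.
Qed.

End Antiderivatives.

(** * Summation over the thresholds *)

Arguments gain : simpl never.

Theorem theorem3 (R : realFieldType) (n k : nat) (s : nat -> nat)
    (hk : (1 <= k < n)%N)
    (hs : forall l : nat, (1 <= l <= k)%N -> (l <= s l < n)%N)
    (hmono : forall l m : nat,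
       (1 <= l)%N -> (l <= m)%N -> (m <= k)%N -> (s l <= s m)%N) :
  let t (l : nat) : nat := (s l - l + 1)%N in
  success_probability R n k s =
    - (\sum_(0 <= i < k) (\prod_(1 <= j < i.+1) (t j)%:R) * d R n k i (t i.+1))
    - (\prod_(1 <= j < k.+1) (t j)%:R) * delta R k n.
Proof.
move=> t; rewrite /success_probability card_success //.
rewrite win_probability; last by lia.
pose T l : R := \prod_(1 <= j < l.+1) (t j)%:R.
pose D l : R := \sum_(0 <= i < l) T i * d R n k i (t i.+1).
(* [N i] counts orderings of [i] candidates without a stop; [S i] is the success probability
   contributed by the first [i] times. *)
pose N i : R := (num_skipped (level n k s) i)%:R.
pose S i : R := \sum_(j < i) N j / j.+1`!%:R
                  * hyper_mean_min R n k j.+1 (level n k s j).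
have NS i : N i.+1 = (i.+1 - level n k s i)%:R * N i.
  by rewrite /N num_skippedS natrM.
have SS i : S i.+1 = S i + N i / i.+1`!%:R
      * hyper_mean_min R n k i.+1 (level n k s i) by rewrite /S big_ord_recr.
(* Invariant on s_l <= i <= s_{l+1}, by induction on [l] and then on [i]; [D] collects the jumps at
   the thresholds passed. *)
have partial l i : (l <= k)%N -> (0 < l -> s l <= i)%N ->
    (i <= threshold n k s l.+1)%N ->
    N i = T l * (i - l)`!%:R /\ S i = T l * gain R n k l i - D l.
  elim: l i => [|l IHl] i le_lk.
    move=> _; elim: i => [|i IHi] le_i.
      rewrite /N /S num_skipped0 big_ord0 /T /D !big_geq //.
      by rewrite mulr0 subr0 mul1r.
    have lt_i : (i.+1 < n)%N.
      by apply: leq_ltn_trans le_i _; apply: (threshold_lt hs); lia.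
    have [N_i S_i] := IHi (ltnW le_i).
    have level_i : level n k s i = 0%N by apply: (levelE hmono).
    split; first by rewrite NS N_i level_i !subn0 factS natrM mulrCA.
    rewrite SS S_i level_i hyper_mean_min0 /gain.
    by rewrite !mulr0 addr0.
  have /andP[lt_l lt_s] := hs l.+1 ltac:(lia).
  (* The end of one interval starts the next: the top factor of the factorial moves into [T] as
     t_{l+1}, and [gain_switch] supplies the new term of [D]. *)
  have start : N (s l.+1) = T l.+1 * (s l.+1 - l.+1)`!%:R
       /\ S (s l.+1) = T l.+1 * gain R n k l.+1 (s l.+1) - D l.+1.
    have [||N_s S_s] := IHl (s l.+1) (ltnW le_lk).
    - by move=> l_gt0; apply: hmono; lia.
    - by rewrite /threshold ltn_eqF.
    have t_l : t l.+1 = (s l.+1 - l)%N by rewrite /t; lia.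
    have TS : T l.+1 = T l * (s l.+1 - l)%:R.
      by rewrite /T big_nat_recr //= t_l.
    split.
      rewrite N_s TS; have -> : (s l.+1 - l = (s l.+1 - l.+1).+1)%N by lia.
      by rewrite factS natrM mulrA.
    rewrite S_s /D big_nat_recr //= -/(D l) t_l -gain_switch //.
    by rewrite TS; ring.
  move=> /(_ isT) ge_i; rewrite -(subnKC ge_i).
  elim: (i - s l.+1)%N => [|e IHe] le_i; first by rewrite addn0.
  rewrite addnS in le_i *; set j := (s l.+1 + e)%N in IHe le_i *.
  have lt_j : (j.+1 < n)%N.
    by apply: leq_ltn_trans le_i _; apply: (threshold_lt hs); lia.
  have [N_j S_j] := IHe (ltnW le_i).
  have level_j : level n k s j = l.+1.
    by apply: (levelE hmono) => // _; rewrite leq_addr.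
  have le_lj : (l < j)%N by apply: leq_trans lt_l (leq_addr _ _).
  split.
    by rewrite NS N_j level_j subSn // factS natrM mulrCA.
  rewrite SS S_j level_j N_j -[LHS]addrA.
  have := @gain_step R n k hk l.+1 j le_lj lt_j.
  set Aj := gain _ _ _ _ j => /(canRL (subrK _)) ->.
  by ring.
(* Since s_{k+1} = n - 1, the invariant reaches [n.-1]; only the default choice at time [n]
   remains. *)
have [||] := partial k n.-1 (leqnn k).
- by move=> k_gt0; have := hs k; lia.
- by rewrite /threshold eqxx.
have n_gt0 : (0 < n)%N by lia.
have level_n : level n k s n.-1 = n by rewrite /level prednK // eqxx.
move=> N_n S_n; rewrite -/(S n) -[X in S X](prednK n_gt0) SS S_n N_n level_n.
rewrite prednK // {1}/hyper_mean_min hyper_sum_full; last by lia.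
rewrite binn divr1 (minn_idPr _); last by lia.
rewrite -/(T k) -/(D k) -mulrN -(gain_last R hk).
by ring.
Qed.
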